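(* Let $n\ge 3$ and let $S\subset[n-1]$ be a nonempty proper subset. Then \[\max\{d_H(\sigma,\rho):\sigma,\rho\in\mathcal{D}(S;n),\ \sigma\ne\rho\}=\begin{cases} n-1 & \text{if } S=\{i,i+1,\ldots,j\} \text{ (a set of consecutive integers) with } i=1 \text{ or } j=n-1,\\ n & \text{otherwise.}\end{cases}\]
   Context: $[m]=\{1,\ldots,m\}$. $S_n$ is the symmetric group on $[n]$, with permutations in one-line notation $\sigma=\sigma_1\cdots\sigma_n$. The descent set of $\sigma$ is $\mathcal{D}(\sigma)=\{i\in[n-1]:\sigma_i>\sigma_{i+1}\}$, and for $S\subseteq[n-1]$, $\mathcal{D}(S;n)=\{\sigma\in S_n:\mathcal{D}(\sigma)=S\}$. The Hamming metric is $d_H(\sigma,\rho)=|\{i\in[n]:\sigma_i\ne\rho_i\}|$. *)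

(* Defs.v *)
From mathcomp Require Import all_boot all_fingroup.
Set Implicit Arguments.
Unset Strict Implicit.
Unset Printing Implicit Defensive.

(* All indices are shifted down by one: 'I_n stands for [n] and 'I_n.-1 for
   [n-1], the ordinal of value i representing the integer i.+1. *)

Definition pos n (i : 'I_n.-1) : 'I_n := widen_ord (leq_pred n) i.

(* [lift (pos i) i] has value [bump i i], i.e. [i.+1]. *)
Definition next_pos n (i : 'I_n.-1) : 'I_n := lift (pos i) i.

Definition descent_set n (s : 'S_n) : {set 'I_n.-1} :=
  [set i | s (next_pos i) < s (pos i)].

Definition descent_class n (S : {set 'I_n.-1}) : {set 'S_n} :=
  [set s | descent_set s == S].

Definition hamming n (s r : 'S_n) : nat := #|[set i | s i != r i]|.

(* S = {i, ..., j} with i = 1 or j = n-1, in the shifted indexing. *)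
Definition end_interval n (S : {set 'I_n.-1}) : bool :=
  [exists i : 'I_n.-1, exists j : 'I_n.-1,
    [&& i <= j, S == [set k : 'I_n.-1 | i <= k <= j]
      & (i.+1 == 1) || (j.+1 == n.-1)]].

(* Main.v *)
Require Import Defs.
From mathcomp Require Import all_boot all_fingroup.
From mathcomp Require Import zify.
Set Implicit Arguments.
Unset Strict Implicit.
Unset Printing Implicit Defensive.

(* Read S as a word of ascents and descents. If the word has a single turn, say
   an ascending run followed by a descending one, then every permutation of the
   class takes its maximal value at the turn, and two explicit permutations
   differ everywhere else.
   Appending an ascent to two realizations which differ except possibly at
   common maxima in non-final position yields an everywhere different pair: one
   of the two does not end with the maximal value, so it may be extended by the
   second largest new value, and the other one by the largest. Hence a
   single-turn word followed by its first letter is realized by an everywhere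
   different pair, and appending letters preserves this property; complementing
   the values exchanges ascents and descents. *)

(* The letter [true] is a descent, and [f] is read as a one-line notation: only
   its values on [0, size w] matter. *)
Definition realizes (w : seq bool) (f : nat -> nat) : Prop :=
  [/\ forall i, i <= size w -> f i <= size w,
      forall i j, i <= size w -> j <= size w -> f i = f j -> i = j
    & forall i, i < size w -> (f i.+1 < f i) = nth false w i].

Definition realized_apart (w : seq bool) (A : pred nat) : Prop :=
  exists f g, [/\ realizes w f, realizes w g
                & forall i, i <= size w -> A i -> f i <> g i].

Lemma realizes_onto w f a :
  realizes w f -> a <= size w -> exists2 i, i <= size w & f i = a.
Proof.
case=> le_f inj_f _ le_a.
have uniq_f : uniq (mkseq f (size w).+1).
  by apply/mkseq_uniqP => i j le_i le_j; apply: inj_f.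
have sub_f : {subset mkseq f (size w).+1 <= iota 0 (size w).+1}.
  by move=> _ /mapP[i + ->]; rewrite !mem_iota !add0n !ltnS; apply: le_f.
have [|_ eq_f] := uniq_min_size uniq_f sub_f.
  by rewrite size_mkseq size_iota.
have := eq_f a; rewrite mem_iota add0n ltnS le_a => /mapP[i].
by rewrite mem_iota add0n ltnS => le_i ->; exists i.
Qed.

Lemma realizes_negb w f :
  realizes w f -> realizes (map negb w) (fun i => size w - f i).
Proof.
rewrite /realizes size_map => -[le_f inj_f desc_f].
split=> [i|i j le_i le_j|i lt_i].
- by rewrite leq_subr.
- by have := le_f i le_i; have := le_f j le_j; have := inj_f i j le_i le_j; lia.
- have le_i := ltnW lt_i; rewrite (nth_map false) // -desc_f //.
  have := inj_f i i.+1 le_i lt_i.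
  by have := le_f i le_i; have := le_f i.+1 lt_i; lia.
Qed.

Lemma realized_apart_negb w A :
  realized_apart w A -> realized_apart (map negb w) A.
Proof.
case=> f [g [rf rg neq_fg]].
exists (fun i => size w - f i), (fun i => size w - g i).
split=> [||i]; try exact: realizes_negb.
case: rf rg => [le_f _ _] [le_g _ _]; rewrite size_map => le_i /(neq_fg i le_i).
by have := le_f i le_i; have := le_g i le_i; lia.
Qed.

Lemma realizes_rcons w f a :
  realizes w f -> a <= (size w).+1 ->
  realizes (rcons w (a <= f (size w)))
    (fun i => if i <= size w then bump a (f i) else a).
Proof.
rewrite /realizes size_rcons => -[le_f inj_f desc_f] le_a.
split=> [i _|i j le_i le_j|i].
- by have := le_f i; rewrite /bump; case: ifP; lia.
- by have := inj_f i j; rewrite /bump; do 2 (case: ifP => ?); lia.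
rewrite ltnS nth_rcons => le_i; rewrite le_i.
have [lt_i|ge_i] := ltnP i (size w); last first.
  have ->: i = size w by lia.
  by rewrite eqxx /bump; lia.
by rewrite -desc_f // /bump; lia.
Qed.

Lemma realized_apart_rcons_ascent w (A : pred nat) :
  (forall i, i <= size w -> ~~ A i ->
     i < size w /\ forall f, realizes w f -> f i = size w) ->
  realized_apart w A -> realized_apart (rcons w false) predT.
Proof.
move=> common_max [f [g [rf rg neq_fg]]].
have A_last : A (size w).
  by apply: contraT => /(common_max _ (leqnn _))[]; rewrite ltnn.
wlog g_last : f g rf rg neq_fg / g (size w) < size w.
  move=> apart_fg; have [|g_last] := ltnP (g (size w)) (size w).
    exact: apart_fg rf rg neq_fg.
  apply: (apart_fg g f) => // [i le_i Ai /esym|]; first exact: neq_fg.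
  case: rf rg => [le_f _ _] [le_g _ _].
  have := neq_fg _ (leqnn _) A_last.
  by have := le_f _ (leqnn _); have := le_g _ (leqnn _); lia.
have := realizes_rcons rf (leqnn _); have := realizes_rcons rg (leqnSn _).
have [le_f _ _] := rf; have [le_g _ _] := rg.
rewrite (leqNgt (size w)) g_last ltnNge le_f //= => rg' rf'.
do 2 eexists; split; [exact: rf' | exact: rg' |].
move=> i _ _; rewrite /bump; have [le_i|_] := leqP i (size w); last by lia.
have [Ai|/(common_max i le_i)[_ max_i]] := boolP (A i).
  by have := neq_fg i le_i Ai; have := le_f i le_i; have := le_g i le_i; lia.
by rewrite (max_i f rf) (max_i g rg); lia.
Qed.

Lemma realized_apart_rcons w b :
  realized_apart w predT -> realized_apart (rcons w b) predT.
Proof.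
have rcons_ascent v :
    realized_apart v predT -> realized_apart (rcons v false) predT.
  exact: realized_apart_rcons_ascent.
case: b => [apart_w|]; last exact: rcons_ascent.
rewrite -[rcons w true](mapK negbK) map_rcons.
by apply/realized_apart_negb/rcons_ascent/realized_apart_negb.
Qed.

Definition turn_word (k l : nat) (c : bool) : seq bool :=
  nseq k c ++ nseq l (~~ c).

Definition one_turn (w : seq bool) : Prop :=
  exists k l c, [/\ 0 < k, 0 < l & w = turn_word k l c].

Lemma size_turn_word k l c : size (turn_word k l c) = k + l.
Proof. by rewrite size_cat !size_nseq. Qed.

Lemma nth_turn_word k l c i :
  i < k + l -> nth false (turn_word k l c) i = ((i < k) == c).
Proof.
move=> lt_i; rewrite nth_cat size_nseq !nth_nseq.
by case: ltnP => le_k; [case: c | rewrite ifT; [case: c | lia]].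
Qed.

Lemma map_negb_turn_word k l c :
  map negb (turn_word k l c) = turn_word k l (~~ c).
Proof. by rewrite map_cat !map_nseq. Qed.

Lemma rcons_nseq T k (x : T) : rcons (nseq k x) x = nseq k.+1 x.
Proof. by rewrite -cats1 -addn1 nseqD. Qed.

Lemma rcons_turn_word k l c :
  rcons (turn_word k l c) (~~ c) = turn_word k l.+1 c.
Proof. by rewrite rcons_cat rcons_nseq. Qed.

Lemma realizes_peak k l f :
  realizes (turn_word k l false) f -> f k = k + l.
Proof.
move=> rf; have [i] := realizes_onto rf (leqnn _).
case: rf; rewrite size_turn_word => le_f _ desc_f le_i f_i.
suff: f i <= f k by have := le_f k; lia.
have ascending : {in [pred j | j <= k] &, {homo f : i j / i <= j}}.
  apply: homo_leq_in => // [y x z|x y|x].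
  - exact: leq_trans.
  - by rewrite !inE => ? ? z; rewrite !inE; lia.
  - rewrite !inE => _ lt_xk.
    by rewrite leqNgt desc_f ?nth_turn_word ?lt_xk //; lia.
have descending :
    {in [pred j | k <= j <= k + l] &, {homo f : i j / i <= j >-> i >= j}}.
  apply: homo_leq_in => // [y x z|x y|x].
  - by move=> /[swap]; apply: leq_trans.
  - by rewrite !inE => ? ? z; rewrite !inE; lia.
  - rewrite !inE => le_kx lt_x; apply: ltnW.
    by rewrite desc_f ?nth_turn_word //; lia.
case: (leqP i k) => [le_ik|/ltnW le_ki].
  by apply: ascending; rewrite ?inE.
by apply: descending; rewrite ?inE; lia.
Qed.

Lemma realizes_turn_agree k l c f g :
  realizes (turn_word k l c) f -> realizes (turn_word k l c) g -> f k = g k.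
Proof.
case: c => [rf rg|/realizes_peak-> /realizes_peak-> //].
have [le_f _ _] := rf; have [le_g _ _] := rg.
have := realizes_negb rf; have := realizes_negb rg.
rewrite map_negb_turn_word => /realizes_peak + /realizes_peak.
by have := le_f k; have := le_g k; rewrite size_turn_word; lia.
Qed.

Lemma realized_apart_turn k l c :
  0 < k -> 0 < l -> realized_apart (turn_word k l c) (predC1 k).
Proof.
move=> k_gt0 l_gt0.
suff peak : realized_apart (turn_word k l false) (predC1 k).
  case: c => //; have := realized_apart_negb peak.
  by rewrite map_negb_turn_word.
(* The ascending run takes the largest, resp. the smallest, available values. *)
exists (fun i => if i <= k then l + i else k + l - i).
exists (fun i => if i < k then i else k + l - (i - k)).
rewrite /realizes size_turn_word.
split; [split=> [i|i j|i lt_i] | split=> [i|i j|i lt_i]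
       | move=> i /= le_i neq_ik];
  by rewrite ?nth_turn_word //; do ?case: ifP => ?; lia.
Qed.

Lemma realized_apart_turn_rcons k l c :
  0 < k -> 0 < l -> realized_apart (rcons (turn_word k l c) c) predT.
Proof.
move=> k_gt0 l_gt0.
suff peak : realized_apart (rcons (turn_word k l false) false) predT.
  case: c => //; have := realized_apart_negb peak.
  by rewrite map_rcons map_negb_turn_word.
apply: realized_apart_rcons_ascent (realized_apart_turn false k_gt0 l_gt0).
move=> i _ /negPn/eqP->; rewrite size_turn_word; split=> [|f]; first by lia.
exact: realizes_peak.
Qed.

Lemma word_constant_turn_or_apart w :
  [\/ exists k c, w = nseq k c, one_turn w | realized_apart w predT].
Proof.
elim/last_ind: w => [|w b [[k [c ->]]|[k [l [c [k_gt0 l_gt0 ->]]]]|apart_w]].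
- by constructor 1; exists 0, true.
- have [->|b_neq_c] := eqVneq b c.
    by constructor 1; exists k.+1, c; rewrite rcons_nseq.
  case: k => [|k]; first by constructor 1; exists 1, b.
  constructor 2; exists k.+1, 1, c; split=> //.
  by rewrite -cats1; case: b c b_neq_c => [] [].
- have [->|b_neq_c] := eqVneq b c.
    by constructor 3; apply: realized_apart_turn_rcons.
  constructor 2; exists k, l.+1, c; split=> //.
  by rewrite -rcons_turn_word; case: b c b_neq_c => [] [].
- by constructor 3; apply: realized_apart_rcons.
Qed.

Definition set_word n (S : {set 'I_n}) : seq bool := [seq i \in S | i : 'I_n].

Lemma size_set_word n (S : {set 'I_n}) : size (set_word S) = n.
Proof. by rewrite size_map size_enum_ord. Qed.

Lemma nth_set_word n (S : {set 'I_n}) (i : 'I_n) :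
  nth false (set_word S) i = (i \in S).
Proof. by rewrite (nth_map i) ?size_enum_ord ?nth_ord_enum. Qed.

Lemma set_word_nseq n (S : {set 'I_n}) k c :
  set_word S = nseq k c -> S = if c then setT else set0.
Proof.
move=> wS; have eq_kn : k = n by rewrite -(size_set_word S) wS size_nseq.
apply/setP=> i; rewrite -nth_set_word wS nth_nseq eq_kn ltn_ord.
by case: c {wS}; rewrite inE.
Qed.

Lemma set_word_turnP n (S : {set 'I_n}) k l c :
  set_word S = turn_word k l c <->
  n = k + l /\ forall i : 'I_n, (i \in S) = ((i < k) == c).
Proof.
split=> [wS|[def_n memS]].
  have def_n : n = k + l by rewrite -(size_set_word S) wS size_turn_word.
  by split=> // i; rewrite -nth_set_word wS nth_turn_word -?def_n.
apply: (@eq_from_nth _ false) => [|i]; rewrite size_set_word.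
  by rewrite size_turn_word.
move=> lt_i; rewrite nth_turn_word -?def_n //.
by rewrite -[i]/(val (Ordinal lt_i)) nth_set_word memS.
Qed.

Lemma end_intervalP n (S : {set 'I_n}) :
  S \proper [set: 'I_n] ->
  reflect (one_turn (set_word S)) (@end_interval n.+1 S).
Proof.
move=> S_proper; apply: (iffP existsP).
  have /properP[_ [x _ xS]] := S_proper.
  move=> [[i lt_i] /existsP[[j lt_j] /and3P[/= le_ij /eqP defS ends]]].
  rewrite defS inE /= in xS; have := ltn_ord x => lt_x.
  have [i0|i_gt0] := posnP i.
    exists j.+1, (n - j.+1), true; split; [by []|lia|].
    by apply/set_word_turnP; split=> [|k]; [|rewrite defS inE /=]; lia.
  exists i, (n - i), false; split=> //; first by lia.
  apply/set_word_turnP; split=> [|k]; first by lia.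
  by rewrite defS inE /=; have := ltn_ord k; lia.
move=> [k [l [c [k_gt0 l_gt0 /set_word_turnP[def_n memS]]]]].
have lt_k : k < n by lia.
have lt_0 : 0 < n by lia.
have lt_k1 : k.-1 < n by lia.
have lt_n1 : n.-1 < n by lia.
exists (if c then Ordinal lt_0 else Ordinal lt_k).
apply/existsP; exists (if c then Ordinal lt_k1 else Ordinal lt_n1).
apply/and3P; case: c memS => memS; split=> //=; try lia.
  by apply/eqP/setP=> i; rewrite memS inE /=; lia.
by apply/eqP/setP=> i; rewrite memS inE /=; have := ltn_ord i; lia.
Qed.

Lemma descent_class_realizes n (S : {set 'I_n}) (s : 'S_n.+1) :
  s \in @descent_class n.+1 S <-> realizes (set_word S) (fun i => s (inord i)).
Proof.
have inord_pos (k : 'I_n) : inord k = @pos n.+1 k.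
  by apply/val_inj; rewrite /= inordK // ltnS ltnW.
have inord_next (k : 'I_n) : inord k.+1 = @next_pos n.+1 k.
  by apply/val_inj; rewrite /= inordK ?ltnS // /bump leqnn.
rewrite /realizes size_set_word inE; split=> [/eqP defS|[_ _ desc_s]].
  split=> [i _|i j le_i le_j|i lt_i]; first exact: leq_ord.
    by move/val_inj/perm_inj/(congr1 val); rewrite /= !inordK.
  rewrite -[i]/(val (Ordinal lt_i)).
  by rewrite nth_set_word -defS inE inord_pos inord_next.
apply/eqP/setP=> k; rewrite inE -nth_set_word -desc_s //.
by rewrite inord_pos inord_next.
Qed.

Lemma realizes_ex_perm n (S : {set 'I_n}) f :
  realizes (set_word S) f ->
  exists2 s : 'S_n.+1, s \in @descent_class n.+1 S
    & forall i : 'I_n.+1, s i = f i :> nat.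
Proof.
move=> rf; have := rf; rewrite /realizes size_set_word => -[le_f inj_f desc_f].
have inj_inord : injective (fun i : 'I_n.+1 => inord (f i) : 'I_n.+1).
  move=> i j /(congr1 val); rewrite /= !inordK ?ltnS ?le_f ?leq_ord //.
  by move/inj_f => eq_ij; apply/val_inj/eq_ij; apply: leq_ord.
have sE (i : 'I_n.+1) : perm inj_inord i = f i :> nat.
  by rewrite permE inordK // ltnS le_f ?leq_ord.
exists (perm inj_inord) => //; apply/descent_class_realizes.
rewrite /realizes size_set_word; split=> [i le_i|i j le_i le_j|i lt_i].
- exact: leq_ord.
- by rewrite !sE !inordK //; apply: inj_f.
- by rewrite !sE !inordK ?desc_f // ltnS ltnW.
Qed.

Definition max_hamming n (S : {set 'I_n.-1}) : nat :=
  \max_(p : 'S_n * 'S_n | [&& p.1 \in descent_class S, p.2 \in descent_class S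
                            & p.1 != p.2])
     hamming p.1 p.2.

Lemma hammingxx n (s : 'S_n) : hamming s s = 0.
Proof. by apply: eq_card0 => i; rewrite !inE eqxx. Qed.

Lemma leq_max_hamming n (S : {set 'I_n.-1}) (s r : 'S_n) :
  s \in descent_class S -> r \in descent_class S ->
  hamming s r <= max_hamming S.
Proof.
move=> sS rS; have [->|neq_sr] := eqVneq s r; first by rewrite hammingxx.
by apply: (@leq_bigmax_cond _ _ _ (s, r)); rewrite /= sS rS neq_sr.
Qed.

Lemma max_hamming_leq n (S : {set 'I_n.-1}) : max_hamming S <= n.
Proof.
by apply/bigmax_leqP=> p _; rewrite -[X in _ <= X]card_ord max_card.
Qed.

Lemma leq_max_hamming_apart n (S : {set 'I_n}) A :
  realized_apart (set_word S) A ->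
  #|[set i : 'I_n.+1 | A i]| <= @max_hamming n.+1 S.
Proof.
case=> f [g [/realizes_ex_perm[s sS sE] /realizes_ex_perm[r rS rE] neq_fg]].
apply: leq_trans (leq_max_hamming sS rS).
apply/subset_leq_card/subsetP=> i; rewrite !inE => Ai.
rewrite size_set_word in neq_fg; have := neq_fg i (leq_ord i) Ai.
by apply: contra_notN => /eqP eq_sr; rewrite -sE -rE eq_sr.
Qed.

Lemma max_hamming_apart n (S : {set 'I_n}) :
  realized_apart (set_word S) predT -> @max_hamming n.+1 S = n.+1.
Proof.
move=> /leq_max_hamming_apart; rewrite cardsT card_ord => le_max.
by apply/eqP; rewrite eqn_leq le_max max_hamming_leq.
Qed.

Lemma max_hamming_one_turn n (S : {set 'I_n}) :
  one_turn (set_word S) -> @max_hamming n.+1 S = n.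
Proof.
move=> [k [l [c [k_gt0 l_gt0 wS]]]].
have [def_n _] := iffLR (set_word_turnP S k l c) wS.
have inord_k : val (inord k : 'I_n.+1) = k by rewrite /= inordK //; lia.
have card_k : #|[set~ inord k : 'I_n.+1]| = n by rewrite cardsC1 card_ord.
apply/eqP; rewrite eqn_leq -{3}card_k; apply/andP; split.
  apply/bigmax_leqP=> -[s r] /= /and3P[].
  move=> /descent_class_realizes + /descent_class_realizes + _.
  rewrite wS => rs rr; have eq_k := val_inj (realizes_turn_agree rs rr).
  rewrite -[X in _ <= X]card_k; apply/subset_leq_card/subsetP=> i.
  by rewrite !inE; apply: contraNneq => ->; rewrite eq_k.
have := realized_apart_turn c k_gt0 l_gt0; rewrite -wS.
move=> /leq_max_hamming_apart; apply: leq_trans.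
by apply/subset_leq_card/subsetP=> i; rewrite !inE /= -val_eqE /= inord_k.
Qed.

Theorem theorem3p2 (n : nat) (S : {set 'I_n.-1}) (hn : 3 <= n)
    (hS0 : S != set0) (hS1 : S \proper [set: 'I_n.-1]) :
  \max_(p : 'S_n * 'S_n | [&& p.1 \in descent_class S, p.2 \in descent_class S
                            & p.1 != p.2])
     hamming p.1 p.2
  = if end_interval S then n.-1 else n.
Proof.
case: n S hn hS0 hS1 => [//|n] S _ S_neq0 S_proper; rewrite -/(max_hamming S).
case: (end_intervalP S_proper) => [one_turn_S|not_one_turn].
  exact: max_hamming_one_turn.
have [[k [c /set_word_nseq defS]]|//|] :=
    word_constant_turn_or_apart (set_word S).
  by case: c defS S_neq0 S_proper => ->; rewrite ?eqxx ?properxx.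
exact: max_hamming_apart.
Qed.
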